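(* Consider the following part of a representation of a grid: complex vector spaces $V_{n,m},V_{n+1,m},V_{n,m+1},V_{n+1,m+1}$ with linear operators $$A^+_{n+1,m}:V_{n,m}\to V_{n+1,m},\quad A^-_{n+1,m}:V_{n+1,m}\to V_{n,m},$$ $$A^+_{n+1,m+1}:V_{n,m+1}\to V_{n+1,m+1},\quad A^-_{n+1,m+1}:V_{n+1,m+1}\to V_{n,m+1},$$ $$B^+_{n,m+1}:V_{n,m}\to V_{n,m+1},\quad B^-_{n,m+1}:V_{n,m+1}\to V_{n,m},$$ $$B^+_{n+1,m+1}:V_{n+1,m}\to V_{n+1,m+1},\quad B^-_{n+1,m+1}:V_{n+1,m+1}\to V_{n+1,m}.$$ Assume that the eight narrow circuit endomorphisms act as scalars as follows, with numbers $\alpha_{n+1,m},\alpha_{n+1,m+1},\beta_{n,m+1},\beta_{n+1,m+1}$: $$A^-_{n+1,m}A^+_{n+1,m}=\alpha_{n+1,m},\qquad A^+_{n+1,m}A^-_{n+1,m}=\alpha_{n+1,m},$$ $$B^-_{n+1,m+1}B^+_{n+1,m+1}=\beta_{n+1,m+1},\qquad B^+_{n+1,m+1}B^-_{n+1,m+1}=\beta_{n+1,m+1},$$ $$A^+_{n+1,m+1}A^-_{n+1,m+1}=\alpha_{n+1,m+1},\qquad A^-_{n+1,m+1}A^+_{n+1,m+1}=\alpha_{n+1,m+1},$$ $$B^+_{n,m+1}B^-_{n,m+1}=\beta_{n,m+1},\qquad B^-_{n,m+1}B^+_{n,m+1}=\beta_{n,m+1}.$$ Let $\gamma_{nm},\delta_{nm}$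 be two more numbers such that their product equals the product of the four numbers: $$\beta_{n,m+1}\,\alpha_{n+1,m+1}\,\beta_{n+1,m+1}\,\alpha_{n+1,m}=\gamma_{nm}\,\delta_{nm}.$$ Then the following sixteen equations are equivalent: 1. $B^-_{n,m+1}A^-_{n+1,m+1}B^+_{n+1,m+1}A^+_{n+1,m}=\gamma_{nm}$ on $V_{n,m}$; 2. $A^+_{n+1,m}B^-_{n,m+1}A^-_{n+1,m+1}B^+_{n+1,m+1}=\gamma_{nm}$ on $V_{n+1,m}$; 3. $B^+_{n+1,m+1}A^+_{n+1,m}B^-_{n,m+1}A^-_{n+1,m+1}=\gamma_{nm}$ on $V_{n+1,m+1}$; 4. $A^-_{n+1,m+1}B^+_{n+1,m+1}A^+_{n+1,m}B^-_{n,m+1}=\gamma_{nm}$ on $V_{n,m+1}$; 5. $A^-_{n+1,m}B^-_{n+1,m+1}A^+_{n+1,m+1}B^+_{n,m+1}=\delta_{nm}$ on $V_{n,m}$; 6. $B^+_{n,m+1}A^-_{n+1,m}B^-_{n+1,m+1}A^+_{n+1,m+1}=\delta_{nm}$ on $V_{n,m+1}$; 7. $A^+_{n+1,m+1}B^+_{n,m+1}A^-_{n+1,m}B^-_{n+1,m+1}=\delta_{nm}$ on $V_{n+1,m+1}$; 8. $B^-_{n+1,m+1}A^+_{n+1,m+1}B^+_{n,m+1}A^-_{n+1,m}=\delta_{nm}$ on $V_{n+1,m}$; 9. $A^+_{n+1,m+1}B^+_{n,m+1}=\frac{\alpha_{n+1,m+1}\beta_{n,m+1}}{\gamma_{nm}}\,B^+_{n+1,m+1}A^+_{n+1,m}$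 as maps $V_{n,m}\to V_{n+1,m+1}$; 10. $B^+_{n,m+1}A^-_{n+1,m}=\frac{\alpha_{n+1,m}\beta_{n,m+1}}{\gamma_{nm}}\,A^-_{n+1,m+1}B^+_{n+1,m+1}$ as maps $V_{n+1,m}\to V_{n,m+1}$; 11. $A^-_{n+1,m}B^-_{n+1,m+1}=\frac{\alpha_{n+1,m}\beta_{n+1,m+1}}{\gamma_{nm}}\,B^-_{n,m+1}A^-_{n+1,m+1}$ as maps $V_{n+1,m+1}\to V_{n,m}$; 12. $B^-_{n+1,m+1}A^+_{n+1,m+1}=\frac{\alpha_{n+1,m+1}\beta_{n+1,m+1}}{\gamma_{nm}}\,A^+_{n+1,m}B^-_{n,m+1}$ as maps $V_{n,m+1}\to V_{n+1,m}$; 13. $B^+_{n+1,m+1}A^+_{n+1,m}=\frac{\alpha_{n+1,m}\beta_{n+1,m+1}}{\delta_{nm}}\,A^+_{n+1,m+1}B^+_{n,m+1}$ as maps $V_{n,m}\to V_{n+1,m+1}$; 14. $A^-_{n+1,m+1}B^+_{n+1,m+1}=\frac{\alpha_{n+1,m+1}\beta_{n+1,m+1}}{\delta_{nm}}\,B^+_{n,m+1}A^-_{n+1,m}$ as maps $V_{n+1,m}\to V_{n,m+1}$; 15. $B^-_{n,m+1}A^-_{n+1,m+1}=\frac{\alpha_{n+1,m+1}\beta_{n,m+1}}{\delta_{nm}}\,A^-_{n+1,m}B^-_{n+1,m+1}$ as maps $V_{n+1,m+1}\to V_{n,m}$; 16. $A^+_{n+1,m}B^-_{n,m+1}=\frac{\alpha_{n+1,m}\beta_{n,m+1}}{\delta_{nm}}\,B^-_{n+1,m+1}A^+_{n+1,m+1}$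 as maps $V_{n,m+1}\to V_{n+1,m}$. Equations 1–4 state that the wide circuit endomorphisms along the square in counterclockwise direction act as the same scalar; equations 5–8 contain the same statement for the clockwise direction; equations 9–16 describe the ''up to scalar'' commutativity of the square diagram.
   Context: A grid is a directed graph with vertices indexed by pairs $(n,m)\in\mathbb Z\times\mathbb Z$ and a pair of opposite arrows between neighbouring vertices; a representation assigns a complex vector space to each vertex and a linear operator between the corresponding spaces to each arrow. Here $n$ is the horizontal and $m$ the vertical coordinate, the operators $A^{\pm}$ belong to horizontal arrows and $B^{\pm}$ to vertical arrows. A narrow circuit goes along a path and returns along the opposite path; circuits that are not narrow are called wide. A scalar multiple of the identity operator is identified with the scalar itself, so e.g. ''$A^-A^+=\alpha$'' means $A^-A^+=\alpha\cdot\mathrm{id}$ on the source space of $A^+$. Products of operators are compositions, the rightmost operator being applied first. *)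

(* Defs.v *)
From HB Require Import structures.
From mathcomp Require Import all_boot all_order all_algebra.
From mathcomp Require Import complex reals.

Set Implicit Arguments.
Unset Strict Implicit.
Unset Printing Implicit Defensive.

Import GRing.Theory.
Local Open Scope ring_scope.

Definition acts_as (K : pzRingType) (V : lmodType K) (f : V -> V) (c : K) :
  Prop := f =1 c \*: idfun.

(* Main.v *)
(* The product of the four scalars is [gamma * delta <> 0], so every arrow is
   invertible up to a nonzero scalar. Conjugating by one arrow moves the base
   point of a wide circuit, and cancelling two consecutive arrows turns a wide
   circuit into commutativity of the square up to a scalar. *)
Require Import Defs.
From HB Require Import structures.
From mathcomp Require Import all_boot all_order all_algebra.
From mathcomp Require Import complex reals.
From mathcomp Require Import ring.

Set Implicit Arguments.
Unset Strict Implicit.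
Unset Printing Implicit Defensive.

Import GRing.Theory.
Local Open Scope ring_scope.

Section Circuits.
Variable K : fieldType.

(** With [a^-1 *: f'] as inverse of [f], the map [f \o g] is the conjugate of [g \o f] by [f], and
    conjugation fixes scalars. *)
Lemma acts_as_rotate (U V : lmodType K) (f : {linear U -> V})
    (f' : {linear V -> U}) (g : V -> U) (a c : K) :
  a != 0 -> acts_as (f' \o f) a -> acts_as (f \o f') a ->
  acts_as (g \o f) c <-> acts_as (f \o g) c.
Proof.
move=> a0 f'f ff'; split=> [gf v | fg u].
  rewrite -[v]scale1r -(mulVf a0) -scalerA.
  have /= <- := ff' v.
  rewrite -linearZ /=; have /= -> := gf (a^-1 *: f' v).
  by rewrite linearZ.
apply: (scalerI a0); have /= <- := f'f (g (f u)).
have /= -> := fg (f u).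
rewrite linearZ /=; have /= -> := f'f u.
by rewrite !scalerA mulrC.
Qed.

(** Up to the factor [a * b], [p' \o q'] is inverse to [q \o p], so both sides say that [d *: r]
    equals [c *: (q \o p)]. The separate [d] lets the product be written in either order, as the
    target coefficient requires. *)
Lemma circuit_square (U W V : lmodType K)
    (p : {linear U -> W}) (p' : {linear W -> U})
    (q : {linear W -> V}) (q' : {linear V -> W}) (r : U -> V) (a b c d : K) :
  acts_as (p' \o p) a -> acts_as (p \o p') a ->
  acts_as (q' \o q) b -> acts_as (q \o q') b ->
  c != 0 -> d != 0 -> d = a * b ->
  acts_as (p' \o q' \o r) c <-> q \o p =1 (d / c) \*: r.
Proof.
move=> p'p pp' q'q qq' c0 d0 dab; split=> [circ u | sq u].
  apply: (scalerI c0); rewrite -!linearZ /=.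
  have /= <- := circ u.
  have /= -> := pp' (q' (r u)).
  rewrite linearZ /=; have /= -> := qq' (r u).
  by rewrite !scalerA -dab divfK.
(* Scaling by [d] and moving it inside to [r u] lets [sq] replace [r] by [q \o p] without a
   division; then [q'q] and [p'p] collapse. *)
apply: (scalerI d0); rewrite /= -!linearZ /=.
have -> : d *: r u = c *: q (p u).
  by have /= -> := sq u; rewrite scalerA [c * _]mulrC divfK.
rewrite !linearZ /=; have /= -> := q'q (p u).
rewrite linearZ /=; have /= -> := p'p u.
by rewrite !scalerA dab; congr (_ *: _); ring.
Qed.

Lemma eq_scale_sym (U V : lmodType K) (f g : U -> V) (c d : K) :
  c * d = 1 -> f =1 c \*: g <-> g =1 d \*: f.
Proof.
move=> cd1; split=> fg u; rewrite /= fg /= scalerA ?cd1 ?scale1r //.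
by rewrite mulrC cd1 scale1r.
Qed.

End Circuits.

(* MathComp world. The square has corners V00 = V_{n,m}, V10 = V_{n+1,m},
   V01 = V_{n,m+1}, V11 = V_{n+1,m+1}; the operators A^{+-}_{i,j}, B^{+-}_{i,j}
   and the scalars alpha_{i,j}, beta_{i,j} carry the offsets of (i,j) from
   (n,m), and p/m stand for +/-. *)
Theorem lemma2 (R : realType)
    (V00 V10 V01 V11 : lmodType R[i])
    (Ap10 : {linear V00 -> V10}) (Am10 : {linear V10 -> V00})
    (Ap11 : {linear V01 -> V11}) (Am11 : {linear V11 -> V01})
    (Bp01 : {linear V00 -> V01}) (Bm01 : {linear V01 -> V00})
    (Bp11 : {linear V10 -> V11}) (Bm11 : {linear V11 -> V10})
    (alpha10 alpha11 beta01 beta11 : R[i])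
    (HAmAp10 : acts_as (Am10 \o Ap10) alpha10)
    (HApAm10 : acts_as (Ap10 \o Am10) alpha10)
    (HBmBp11 : acts_as (Bm11 \o Bp11) beta11)
    (HBpBm11 : acts_as (Bp11 \o Bm11) beta11)
    (HApAm11 : acts_as (Ap11 \o Am11) alpha11)
    (HAmAp11 : acts_as (Am11 \o Ap11) alpha11)
    (HBpBm01 : acts_as (Bp01 \o Bm01) beta01)
    (HBmBp01 : acts_as (Bm01 \o Bp01) beta01)
    (gamma delta : R[i])
    (* needed for the fractions in equations 9-16 to be defined *)
    (gamma_neq0 : gamma != 0) (delta_neq0 : delta != 0)
    (Hgd : beta01 * alpha11 * beta11 * alpha10 = gamma * delta) :
  [<-> (*  1 *) acts_as (Bm01 \o Am11 \o Bp11 \o Ap10) gamma;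
       (*  2 *) acts_as (Ap10 \o Bm01 \o Am11 \o Bp11) gamma;
       (*  3 *) acts_as (Bp11 \o Ap10 \o Bm01 \o Am11) gamma;
       (*  4 *) acts_as (Am11 \o Bp11 \o Ap10 \o Bm01) gamma;
       (*  5 *) acts_as (Am10 \o Bm11 \o Ap11 \o Bp01) delta;
       (*  6 *) acts_as (Bp01 \o Am10 \o Bm11 \o Ap11) delta;
       (*  7 *) acts_as (Ap11 \o Bp01 \o Am10 \o Bm11) delta;
       (*  8 *) acts_as (Bm11 \o Ap11 \o Bp01 \o Am10) delta;
       (*  9 *) Ap11 \o Bp01 =1 (alpha11 * beta01 / gamma) \*: (Bp11 \o Ap10);
       (* 10 *) Bp01 \o Am10 =1 (alpha10 * beta01 / gamma) \*: (Am11 \o Bp11);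
       (* 11 *) Am10 \o Bm11 =1 (alpha10 * beta11 / gamma) \*: (Bm01 \o Am11);
       (* 12 *) Bm11 \o Ap11 =1 (alpha11 * beta11 / gamma) \*: (Ap10 \o Bm01);
       (* 13 *) Bp11 \o Ap10 =1 (alpha10 * beta11 / delta) \*: (Ap11 \o Bp01);
       (* 14 *) Am11 \o Bp11 =1 (alpha11 * beta11 / delta) \*: (Bp01 \o Am10);
       (* 15 *) Bm01 \o Am11 =1 (alpha11 * beta01 / delta) \*: (Am10 \o Bm11);
       (* 16 *) Ap10 \o Bm01 =1 (alpha10 * beta01 / delta) \*: (Bm11 \o Ap11)].
Proof.
have : gamma * delta != 0 by rewrite mulf_neq0.
rewrite -Hgd !mulf_eq0 !negb_or => /andP[/andP[/andP[b01 a11] b11] a10].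
have E2 := acts_as_rotate (Bm01 \o Am11 \o Bp11) gamma a10 HAmAp10 HApAm10.
have E3 := acts_as_rotate (Ap10 \o Bm01 \o Am11) gamma b11 HBmBp11 HBpBm11.
have E4 := acts_as_rotate (Bp11 \o Ap10 \o Bm01) gamma a11 HApAm11 HAmAp11.
have E6 := acts_as_rotate (Am10 \o Bm11 \o Ap11) delta b01 HBmBp01 HBpBm01.
have E7 := acts_as_rotate (Bp01 \o Am10 \o Bm11) delta a11 HAmAp11 HApAm11.
have E8 := acts_as_rotate (Ap11 \o Bp01 \o Am10) delta b11 HBpBm11 HBmBp11.
(* Each square equation is paired with the circuit whose first two arrows form its right-hand side:
   9-12 with 1-4, and 13, 14, 15, 16 with 5, 8, 7, 6. *)
have E9 := circuit_square (Bp11 \o Ap10) HBmBp01 HBpBm01 HAmAp11 HApAm11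
  gamma_neq0 (mulf_neq0 a11 b01) (mulrC _ _).
have E10 := circuit_square (Am11 \o Bp11) HApAm10 HAmAp10 HBmBp01 HBpBm01
  gamma_neq0 (mulf_neq0 a10 b01) erefl.
have E11 := circuit_square (Bm01 \o Am11) HBpBm11 HBmBp11 HApAm10 HAmAp10
  gamma_neq0 (mulf_neq0 a10 b11) (mulrC _ _).
have E12 := circuit_square (Ap10 \o Bm01) HAmAp11 HApAm11 HBpBm11 HBmBp11
  gamma_neq0 (mulf_neq0 a11 b11) erefl.
have E13 := circuit_square (Ap11 \o Bp01) HAmAp10 HApAm10 HBmBp11 HBpBm11
  delta_neq0 (mulf_neq0 a10 b11) erefl.
have E14 := circuit_square (Bp01 \o Am10) HBmBp11 HBpBm11 HApAm11 HAmAp11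
  delta_neq0 (mulf_neq0 a11 b11) (mulrC _ _).
have E15 := circuit_square (Am10 \o Bm11) HApAm11 HAmAp11 HBpBm01 HBmBp01
  delta_neq0 (mulf_neq0 a11 b01) erefl.
have E16 := circuit_square (Bm11 \o Ap11) HBpBm01 HBmBp01 HAmAp10 HApAm10
  delta_neq0 (mulf_neq0 a10 b01) (mulrC _ _).
(* By [Hgd] the coefficients of 9 and 13 are reciprocal; this is the one bridge between the [gamma]
   and [delta] families. *)
have ED : alpha11 * beta01 / gamma * (alpha10 * beta11 / delta) = 1.
  rewrite mulf_div (_ : alpha11 * _ * _ = gamma * delta).
    by rewrite divff // mulf_neq0.
  by rewrite -Hgd; ring.
have E913 := eq_scale_sym (Ap11 \o Bp01) (Bp11 \o Ap10) ED.
(* The fifteen equivalences form a tree on the sixteen equations; each implication of the cycle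
   follows a path in it. *)
tfae.
- by move/E2.
- by move/E3.
- by move/E4.
- by move/E4/E3/E2/E9/E913/E13.
- by move/E6.
- by move/E7.
- by move/E8.
- by move/E8/E7/E6/E13/E913.
- by move/E9/E2/E10.
- by move/E10/E3/E11.
- by move/E11/E4/E12.
- by move/E12/E4/E3/E2/E9/E913.
- by move/E13/E6/E7/E8/E14.
- by move/E14/E8/E15.
- by move/E15/E7/E16.
- by move/E16/E6/E13/E913/E9.
Qed.
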